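(* Let $\mathcal H$ be the complex Heisenberg Lie algebra with basis $e_1,e_2,e_3$ and only non-zero bracket $[e_1,e_2]=e_3$. Consider representations of $\mathcal H$ on $V=\langle v_1,v_2,v_3\rangle$ of the form $$\text{(AI)}\qquad f(e_1)=a\,I+E_{21},\quad f(e_2)=a'\,I+E_{32},\quad f(e_3)=E_{31}\qquad(a,a'\in\mathbb C).$$ For such a representation there exist bijective 1-cocycles if and only if it is equivalent to one of the following two cases: (AI-1) $a=1$, $a'=0$. There is only one bijective 1-cocycle up to equivalence, $q=(v_3,v_2,v_1)$, and the corresponding left-symmetric algebra is (H-1): $e_1e_1=e_1$, $e_1e_2=e_2+e_3$, $e_1e_3=e_3$, $e_2e_1=e_2$, $e_3e_1=e_3$. (AI-2) $a=a'=1$. There is only one bijective 1-cocycle up to equivalence, $q=(v_3,v_2+v_3,v_1)$, and the corresponding left-symmetric algebra is (H-2)': $e_1e_1=e_1$, $e_1e_2=e_2+e_3$, $e_1e_3=e_3$, $e_2e_1=e_2$, $e_2e_2=2e_2-e_1$, $e_2e_3=e_3$, $e_3e_1=e_3$, $e_3e_2=e_3$, which is isomorphic to (H-2): $e_1e_1=e_1$, $e_1e_2=e_2+e_3$, $e_1e_3=e_3$, $e_2e_1=e_2$, $e_2e_2=e_3$, $e_3e_1=e_3$. (All products of basis vectors that are not listed are zero.)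
   Context: $E_{ij}\in gl(V)$ is the operator $v_i\mapsto v_j$, $v_k\mapsto 0$ for $k\ne i$; $I$ is the identity. A linear map $q:\mathcal H\to V$ is written $q=(q(e_1),q(e_2),q(e_3))$. A left-symmetric algebra is a vector space with a bilinear product satisfying $(xy)z-x(yz)=(yx)z-y(xz)$. For a representation $f:\mathcal G\to gl(V)$ of a Lie algebra, a 1-cocycle associated to $f$ is a linear map $q:\mathcal G\to V$ with $q([x,y])=f(x)q(y)-f(y)q(x)$; it is bijective if $q$ is a linear isomorphism. A bijective 1-cocycle $(f,q)$ has the corresponding left-symmetric algebra on $\mathcal G$ given by $x*y=q^{-1}(f(x)q(y))$, whose commutator is the bracket of $\mathcal G$. Representations $(f_1,V_1),(f_2,V_2)$ are equivalent if $f_2(x)=g f_1(T(x))g^{-1}$ for some automorphism $T$ of $\mathcal G$ and linear isomorphism $g:V_1\to V_2$. Bijective 1-cocycles $(f_1,q_1),(f_2,q_2)$ are equivalent if there are such $T,g$ with $f_2(x)=g f_1(T(x))g^{-1}$ and $q_2=g q_1T$. *)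

(* Defs.v *)
From HB Require Import structures.
From mathcomp Require Import all_boot all_order all_algebra.
From mathcomp Require Import reals complex ring.

Set Implicit Arguments.
Unset Strict Implicit.
Unset Printing Implicit Defensive.

Import GRing.Theory.
Local Open Scope ring_scope.

Record lieAlgebra (K : fieldType) := LieAlgebra {
  lie_sort :> vectType K;
  bracket : lie_sort -> lie_sort -> lie_sort;
  bracket_linearl : forall y, linear (bracket^~ y);
  bracket_linearr : forall x, linear (bracket x);
  bracket_alt : forall x, bracket x x = 0;
  bracket_jacobi : forall x y z,
    bracket x (bracket y z) + bracket y (bracket z x)
      + bracket z (bracket x y) = 0 }.

Record lieRep (K : fieldType) (G : lieAlgebra K) (V : vectType K) := LieRep {
  rep_fun :> 'Hom(G, 'End(V));
  rep_bracket : forall x y : G,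
    rep_fun (bracket x y) =
      (rep_fun x \o rep_fun y)%VF - (rep_fun y \o rep_fun x)%VF }.

Section Cocycles.
Variables (K : fieldType) (G : lieAlgebra K).

Definition lie_automorphism (T : 'End(G)) : Prop :=
  bijective T /\ forall x y : G, T (bracket x y) = bracket (T x) (T y).

Definition cocycle (V : vectType K) (f : lieRep G V) (q : 'Hom(G, V)) : Prop :=
  forall x y : G, q (bracket x y) = f x (q y) - f y (q x).

Definition bijective_cocycle (V : vectType K) (f : lieRep G V)
    (q : 'Hom(G, V)) : Prop :=
  cocycle f q /\ bijective q.

Definition rep_equiv (V1 V2 : vectType K)
    (f1 : lieRep G V1) (f2 : lieRep G V2) : Prop :=
  exists (T : 'End(G)) (g : 'Hom(V1, V2)),
    [/\ lie_automorphism T, bijective g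
      & forall x : G, f2 x = (g \o f1 (T x) \o g^-1)%VF].

Definition cocycle_equiv (V1 V2 : vectType K)
    (f1 : lieRep G V1) (q1 : 'Hom(G, V1))
    (f2 : lieRep G V2) (q2 : 'Hom(G, V2)) : Prop :=
  exists (T : 'End(G)) (g : 'Hom(V1, V2)),
    [/\ lie_automorphism T, bijective g,
        forall x : G, f2 x = (g \o f1 (T x) \o g^-1)%VF
      & q2 = (g \o q1 \o T)%VF].

(* [q^-1] is the linear (right) inverse of vector.v; it is the inverse of [q]
   when [q] is bijective. *)
Definition cocycle_mul (V : vectType K) (f : lieRep G V) (q : 'Hom(G, V))
    (x y : G) : G :=
  (q^-1)%VF (f x (q y)).

End Cocycles.

Definition left_symmetric_algebra (K : fieldType) (A : vectType K)
    (m : A -> A -> A) : Prop :=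
  [/\ forall y, linear (m^~ y), forall x, linear (m x)
    & forall x y z, m (m x y) z - m x (m y z) = m (m y x) z - m y (m x z)].

Definition lsa_isomorphic (K : fieldType) (A B : vectType K)
    (mA : A -> A -> A) (mB : B -> B -> B) : Prop :=
  exists phi : 'Hom(A, B),
    bijective phi /\ forall x y, phi (mA x y) = mB (phi x) (phi y).

Section Heisenberg.
Variable K : fieldType.

(* Ordinals count from 0, so [i1], [i2], [i3] have values 0, 1, 2. *)
Definition i1 : 'I_3 := 0.
Definition i2 : 'I_3 := 1.
Definition i3 : 'I_3 := 2%:R.

Definition V3 : vectType K := 'rV[K]_3.

(* [v i] is the basis vector v_i of V; the Lie algebra [heis] below also has
   carrier ['rV[K]_3], and [e i] is the same row vector read as e_i. *)
Definition v (i : 'I_3) : V3 := delta_mx 0 i.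

(* The bilinear product whose value on the pair (i-th, j-th) of standard basis
   vectors is the j-th entry of the i-th row of [t]; absent entries are 0. *)
Definition table_mul (t : seq (seq 'rV[K]_3)) (x y : 'rV[K]_3) : 'rV[K]_3 :=
  \sum_(i < 3) \sum_(j < 3) (x 0 i * y 0 j) *: (nth [::] t i)`_j.

Lemma table_mul_linearl t y : linear (table_mul t ^~ y).
Proof.
move=> c x x'; rewrite /table_mul scaler_sumr -big_split /=.
apply: eq_bigr => i _; rewrite scaler_sumr -big_split /=.
by apply: eq_bigr => j _; rewrite !mxE mulrDl scalerDl -mulrA scalerA.
Qed.

Lemma table_mul_linearr t x : linear (table_mul t x).
Proof.
move=> c y y'; rewrite /table_mul scaler_sumr -big_split /=.
apply: eq_bigr => i _; rewrite scaler_sumr -big_split /=.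
by apply: eq_bigr => j _; rewrite !mxE mulrDr scalerDl mulrCA scalerA.
Qed.

Definition heis_bracket : 'rV[K]_3 -> 'rV[K]_3 -> 'rV[K]_3 :=
  table_mul [:: [:: 0; v i3]; [:: - v i3]].

Lemma heis_bracketE x y :
  heis_bracket x y = (x 0 i1 * y 0 i2 - x 0 i2 * y 0 i1) *: v i3.
Proof.
rewrite /heis_bracket /table_mul !big_ord_recl !big_ord0 /= !scaler0.
rewrite !addr0 !add0r scalerN -scalerBl.
by congr ((_ * _ - _ * _) *: _); congr (_ 0 _); apply: val_inj.
Qed.

Lemma heis_bracket_alt x : heis_bracket x x = 0.
Proof. by rewrite heis_bracketE mulrC subrr scale0r. Qed.

Lemma heis_bracket_jacobi x y z :
  heis_bracket x (heis_bracket y z) + heis_bracket y (heis_bracket z x)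
    + heis_bracket z (heis_bracket x y) = 0.
Proof. by rewrite !heis_bracketE !mxE /= !(mulr0, subrr, scale0r, addr0). Qed.

Definition heis : lieAlgebra K :=
  @LieAlgebra K 'rV[K]_3 heis_bracket
    (@table_mul_linearl _) (@table_mul_linearr _)
    heis_bracket_alt heis_bracket_jacobi.

Definition e (i : 'I_3) : heis := v i.

(* The linear map on the Heisenberg algebra sending e_1, e_2, e_3 to
   [w1, w2, w3]. *)
Definition on_basis_fun (W : vectType K) (w1 w2 w3 : W) (x : heis) : W :=
  let c : 'rV[K]_3 := x in c 0 i1 *: w1 + c 0 i2 *: w2 + c 0 i3 *: w3.

Lemma on_basis_is_linear (W : vectType K) (w1 w2 w3 : W) :
  linear (on_basis_fun w1 w2 w3).
Proof.
move=> c x y; rewrite /on_basis_fun /= !mxE !scalerDl !scalerDr !scalerA.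
by rewrite [RHS]addrACA; congr (_ + _); rewrite addrACA.
Qed.

HB.instance Definition _ (W : vectType K) (w1 w2 w3 : W) :=
  GRing.isLinear.Build K heis W *:%R (on_basis_fun w1 w2 w3)
    (on_basis_is_linear w1 w2 w3).

Definition on_basis (W : vectType K) (w1 w2 w3 : W) : 'Hom(heis, W) :=
  linfun (on_basis_fun w1 w2 w3).

(* [E i j] sends v_i to v_j, so it is the transpose of the usual matrix unit
   when matrices act on columns. *)
Definition E_fun (i j : 'I_3) (u : V3) : V3 :=
  (u : 'rV[K]_3) 0 i *: v j.

Lemma E_is_linear i j : linear (E_fun i j).
Proof. by move=> c x y; rewrite /E_fun !mxE scalerDl scalerA. Qed.

HB.instance Definition _ (i j : 'I_3) :=
  GRing.isLinear.Build K V3 V3 *:%R (E_fun i j) (E_is_linear i j).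

Definition E (i j : 'I_3) : 'End(V3) := linfun (E_fun i j).

Definition AI_fun (a a' : K) : 'Hom(heis, 'End(V3)) :=
  on_basis (a *: \1%VF + E i2 i1) (a' *: \1%VF + E i3 i2) (E i3 i1).

Lemma AI_funE a a' (x u : 'rV[K]_3) (c := x) :
  AI_fun a a' x u =
    (c 0 i1 * a + c 0 i2 * a') *: u
    + (c 0 i1 * u 0 i2 + c 0 i3 * u 0 i3) *: v i1
    + (c 0 i2 * u 0 i3) *: v i2.
Proof.
rewrite /AI_fun /on_basis lfunE /= /on_basis_fun -/c.
rewrite !(add_lfunE, scale_lfunE, id_lfunE) !lfunE /= /E_fun.
by apply/rowP => k; rewrite !mxE; ring.
Qed.

Lemma AI_bracket a a' (x y : heis) :
  AI_fun a a' (bracket x y) =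
    (AI_fun a a' x \o AI_fun a a' y)%VF
    - (AI_fun a a' y \o AI_fun a a' x)%VF.
Proof.
apply/lfunP => u; rewrite add_lfunE opp_lfunE !comp_lfunE !AI_funE /=.
rewrite heis_bracketE; apply/rowP => k; rewrite !mxE /=; ring.
Qed.

Definition AI (a a' : K) : lieRep heis V3 := LieRep (AI_bracket a a').

Definition H1_mul : heis -> heis -> heis :=
  table_mul [:: [:: e i1; e i2 + e i3; e i3];
                [:: e i2];
                [:: e i3]].

Definition H2'_mul : heis -> heis -> heis :=
  table_mul [:: [:: e i1; e i2 + e i3;       e i3];
                [:: e i2; 2%:R *: e i2 - e i1; e i3];
                [:: e i3; e i3]].

Definition H2_mul : heis -> heis -> heis :=
  table_mul [:: [:: e i1; e i2 + e i3; e i3];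
                [:: e i2; e i3];
                [:: e i3]].

End Heisenberg.

Arguments e {K} i.
Arguments v {K} i.
Arguments E {K} i j.

(* Main.v *)
Require Import Defs.
From mathcomp Require Import all_boot all_order all_algebra.
From mathcomp Require Import reals complex.
From mathcomp Require Import ring.

Import GRing.Theory.
Local Open Scope ring_scope.

(** In coordinates the representation reads
      f(x) u = (x1 a + x2 a') u + (x1 u2 + x3 u3) v1 + (x2 u3) v2,
    so the cocycle condition on the pairs of basis vectors is a small system
    of equations in the coordinates of q(e1), q(e2), q(e3)
    ([AI_cocycle_eqs]).

    If a = 0, then every solution is singular: for a' = 0 the image of q
    lies in the span of v1 and v2 (here 2 must be invertible), and for a' != 0
    both q(e1) and q(e3) are multiples of v1 ([bijective_AI_cocycle_neq0]).
    If a != 0, rescaling by the automorphism diag(al, de, al de) of the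
    Heisenberg algebra changes (a, a') into (al a, de a') ([AI_rescale]),
    so that (a, a') may be taken to be (1, 0) or (1, 1); and bijective
    cocycles are transported by equivalences of representations
    ([rep_equiv_bijective_cocycle]).

    For a = 1 and any a' = b, the solutions form a family with three
    parameters p1, p2, s ([AI1_cocycle_form]), bijective exactly for s != 0.
    An automorphism e1 |-> e1 + m e3, together with a scaled unipotent map of
    V, brings every such member to p1 = p2 = 0, s = 1
    ([AI_cocycle_normalize]).  This is the uniqueness statement for b = 0 and
    b = 1 at once.  The product x * y is then checked after applying q, and
    the isomorphism from (H-2)' to (H-2) sends e1, e2, e3 to
    e1, e1 - e2, - e3. *)

Set Implicit Arguments.
Unset Strict Implicit.

(** * Bijective linear maps *)

Section LinearBijections.
Variables (K : fieldType) (U W : vectType K).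
Implicit Type g : 'Hom(U, W).

Lemma bij_lfunK g : bijective g -> cancel g (g^-1)%VF.
Proof. by move=> /bij_inj g_inj; apply/lker0_lfunK/lker0P. Qed.

Lemma bij_lfunVK g : bijective g -> cancel (g^-1)%VF g.
Proof.
move=> g_bij w; have [h _ hK] := g_bij.
by rewrite -(hK w) bij_lfunK.
Qed.

Lemma bij_lfunV g : bijective g -> bijective (g^-1)%VF.
Proof. by move=> g_bij; exists g; [apply: bij_lfunVK | apply: bij_lfunK]. Qed.

Lemma bij_lfun_ker0 g :
  \dim {:U} = \dim {:W} -> (forall x, g x = 0 -> x = 0) -> bijective g.
Proof.
move=> dimUW ker_g; have kg0: lker g == 0%VS.
  rewrite -subv0; apply/subvP => x; rewrite memv_ker memv0 => /eqP/ker_g ->.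
  exact: eqxx.
have imgT: limg g = fullv.
  apply/eqP; rewrite eqEdim subvf /= -dimUW limg_dim_eq //.
  by rewrite (eqP kg0) capv0.
exists (g^-1)%VF; first exact: lker0_lfunK.
by move=> w; apply: limg_lfunVK; rewrite imgT memvf.
Qed.

End LinearBijections.

(** * Cocycles of an arbitrary Lie algebra *)

Section GeneralCocycles.
Variables (K : fieldType) (G : lieAlgebra K) (V1 V2 : vectType K).

(** The conjugation formula f2(x) = g f1(T x) g^-1 follows from the
    intertwining relation, which does not mention the inverse. *)
Lemma intertwiner_conj (f1 : lieRep G V1) (f2 : lieRep G V2)
    (T : 'End(G)) (g : 'Hom(V1, V2)) :
  bijective g -> (forall x u, f2 x (g u) = g (f1 (T x) u)) ->
  forall x, f2 x = (g \o f1 (T x) \o g^-1)%VF.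
Proof.
move=> g_bij fg x; apply/lfunP => u.
by rewrite !comp_lfunE /= -fg bij_lfunVK.
Qed.

(** The transported cocycle is g^-1 q T^-1. *)
Lemma rep_equiv_bijective_cocycle (f1 : lieRep G V1) (f2 : lieRep G V2) :
  rep_equiv f1 f2 -> (exists q, bijective_cocycle f2 q) ->
  exists q, bijective_cocycle f1 q.
Proof.
move=> [T [g [[T_bij T_morph] g_bij fE]]] [q [q_coc q_bij]].
exists (g^-1 \o (q \o T^-1))%VF; split; last first.
  have cmp_bij: bijective ((g^-1)%VF \o (q \o (T^-1)%VF)).
    apply: bij_comp; first exact: bij_lfunV g_bij.
    by apply: bij_comp q_bij _; apply: bij_lfunV T_bij.
  by apply: eq_bij cmp_bij _ _ => x; rewrite /= !comp_lfunE.
move=> x y; rewrite !comp_lfunE.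
have TV_morph: (T^-1)%VF (bracket x y) = bracket ((T^-1)%VF x) ((T^-1)%VF y).
  by apply: (bij_inj T_bij); rewrite T_morph !bij_lfunVK.
rewrite TV_morph q_coc !fE !comp_lfunE !bij_lfunVK // linearB /=.
by rewrite !bij_lfunK.
Qed.

(** The cocycle condition says that the commutator of x * y = q^-1(f(x) q(y))
    is the bracket; left-symmetry is then the representation property
    applied to q(z). *)
Lemma cocycle_mul_lsa (f : lieRep G V1) (q : 'Hom(G, V1)) :
  bijective_cocycle f q -> left_symmetric_algebra (cocycle_mul f q).
Proof.
move=> [q_coc q_bij]; rewrite /cocycle_mul; split.
- by move=> y c x x'; rewrite linearP add_lfunE scale_lfunE linearP.
- by move=> x c y y'; rewrite !linearP.
move=> x y z; rewrite !bij_lfunVK //.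
apply/eqP; rewrite subr_eq addrAC -addrA addrC -subr_eq; apply/eqP.
rewrite -!linearB /=; congr ((q^-1)%VF _).
have mul_comm: (q^-1)%VF (f x (q y)) - (q^-1)%VF (f y (q x)) = bracket x y.
  by rewrite -linearB /= -q_coc bij_lfunK.
rewrite -opp_lfunE -add_lfunE -linearB /= mul_comm rep_bracket.
by rewrite add_lfunE opp_lfunE !comp_lfunE.
Qed.

End GeneralCocycles.

(** * Coordinates on the Heisenberg algebra and on V *)

Section Heisenberg.
Variable K : fieldType.
Local Notation heis := (heis K).
Local Notation V3 := (V3 K).

Lemma heis_basisE (x : heis) :
  x = (x : 'rV[K]_3) 0 i1 *: e i1 + (x : 'rV[K]_3) 0 i2 *: e i2
      + (x : 'rV[K]_3) 0 i3 *: e i3.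
Proof.
apply/rowP => -[[|[|[|//]]] lt3]; rewrite !mxE /=.
all: rewrite !(mulr0, mulr1, addr0, add0r).
all: by congr (_ 0 _); apply: val_inj.
Qed.

Lemma row3P (x y : 'rV[K]_3) :
  x 0 i1 = y 0 i1 -> x 0 i2 = y 0 i2 -> x 0 i3 = y 0 i3 -> x = y.
Proof.
move=> eq1 eq2 eq3; apply/rowP => -[[|[|[|//]]] lt3].
- by rewrite (_ : Ordinal lt3 = i1) //; apply: val_inj.
- by rewrite (_ : Ordinal lt3 = i2) //; apply: val_inj.
- by rewrite (_ : Ordinal lt3 = i3) //; apply: val_inj.
Qed.

Lemma on_basisE (W : vectType K) (w1 w2 w3 : W) (x : 'rV[K]_3) :
  on_basis w1 w2 w3 x = x 0 i1 *: w1 + x 0 i2 *: w2 + x 0 i3 *: w3.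
Proof. by rewrite /on_basis lfunE. Qed.

Lemma hom_on_basisE (W : vectType K) (q : 'Hom(heis, W)) :
  q = on_basis (q (e i1)) (q (e i2)) (q (e i3)).
Proof.
apply/lfunP => x; rewrite on_basisE {1}[x]heis_basisE.
by rewrite !linearD !linearZ.
Qed.

(** The vector with coordinates [a], [b], [c] in the standard basis, as an
    element of the common carrier of the Heisenberg algebra and of V. *)
Definition vec3 (a b c : K) : 'rV[K]_3 := a *: v i1 + b *: v i2 + c *: v i3.

Lemma vec3E a b c :
  (vec3 a b c 0 i1 = a) * (vec3 a b c 0 i2 = b) * (vec3 a b c 0 i3 = c).
Proof. by rewrite !mxE /= !(mulr0, mulr1, addr0, add0r). Qed.

Lemma vec3_eta (x : 'rV[K]_3) : x = vec3 (x 0 i1) (x 0 i2) (x 0 i3).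
Proof. exact: heis_basisE. Qed.

Lemma on_basis_vec3 p1 p2 p3 r1 r2 r3 s1 s2 s3 (x : 'rV[K]_3) :
  on_basis (vec3 p1 p2 p3 : V3) (vec3 r1 r2 r3) (vec3 s1 s2 s3) x =
  vec3 (x 0 i1 * p1 + x 0 i2 * r1 + x 0 i3 * s1)
       (x 0 i1 * p2 + x 0 i2 * r2 + x 0 i3 * s2)
       (x 0 i1 * p3 + x 0 i2 * r3 + x 0 i3 * s3).
Proof. by rewrite on_basisE; apply: row3P; rewrite !mxE /=; ring. Qed.

Lemma AI_vec3 a a' (x : heis) (u : V3) :
  AI a a' x u =
  vec3 ((x 0 i1 * a + x 0 i2 * a') * u 0 i1
         + x 0 i1 * u 0 i2 + x 0 i3 * u 0 i3)
       ((x 0 i1 * a + x 0 i2 * a') * u 0 i2 + x 0 i2 * u 0 i3)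
       ((x 0 i1 * a + x 0 i2 * a') * u 0 i3).
Proof. by rewrite AI_funE; apply: row3P; rewrite !mxE /=; ring. Qed.

Lemma heis_bracket_vec3 (x y : heis) :
  bracket x y = vec3 0 0 (x 0 i1 * y 0 i2 - x 0 i2 * y 0 i1).
Proof. by rewrite /= heis_bracketE /vec3 !scale0r !add0r. Qed.

Lemma vec3_inj a b c a' b' c' :
  vec3 a b c = vec3 a' b' c' -> [/\ a = a', b = b' & c = c'].
Proof.
by move=> eq_vec; split;
  [have := congr1 (fun x : 'rV[K]_3 => x 0 i1) eq_vec
  |have := congr1 (fun x : 'rV[K]_3 => x 0 i2) eq_vec
  |have := congr1 (fun x : 'rV[K]_3 => x 0 i3) eq_vec]; rewrite !vec3E.
Qed.

Lemma e_vec3 : ((e i1 = vec3 1 0 0 :> heis) * (e i2 = vec3 0 1 0 :> heis)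
  * (e i3 = vec3 0 0 1 :> heis))%type.
Proof. by split; [split|]; apply: row3P; rewrite vec3E mxE. Qed.

Lemma vec3B a b c a' b' c' :
  vec3 (a - a') (b - b') (c - c') = vec3 a b c - vec3 a' b' c'.
Proof. by apply: row3P; rewrite !(vec3E, mxE) /=; ring. Qed.

Lemma vec3_0 : vec3 0 0 0 = 0.
Proof. by apply: row3P; rewrite vec3E mxE. Qed.

Lemma hom_vec3 (q : 'Hom(heis, V3)) :
  exists p r s : K * K * K,
    q = on_basis (vec3 p.1.1 p.1.2 p.2 : V3) (vec3 r.1.1 r.1.2 r.2)
          (vec3 s.1.1 s.1.2 s.2).
Proof.
pose c (x : 'rV[K]_3) := (x 0 i1, x 0 i2, x 0 i3).
exists (c (q (e i1))), (c (q (e i2))), (c (q (e i3))).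
by rewrite /c /= -!vec3_eta -hom_on_basisE.
Qed.

(** * Cocycles and rescaling of the representations (AI) *)

(** The cocycle condition on (e1, e2), (e1, e3) and (e2, e3), coordinate by
    coordinate. *)
Lemma AI_cocycle_eqs a a' (q : 'Hom(heis, V3)) p1 p2 p3 r1 r2 r3 s1 s2 s3 :
  q = on_basis (vec3 p1 p2 p3 : V3) (vec3 r1 r2 r3) (vec3 s1 s2 s3) ->
  cocycle (AI a a') q ->
  [/\ [/\ s1 = a * r1 + r2 - a' * p1, s2 = a * r2 - a' * p2 - p3
        & s3 = a * r3 - a' * p3],
      [/\ a * s1 + s2 = p3, a * s2 = 0 & a * s3 = 0]
    & [/\ a' * s1 = r3, a' * s2 + s3 = 0 & a' * s3 = 0]].
Proof.
move=> -> q_coc.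
have := q_coc (e i2) (e i3); have := q_coc (e i1) (e i3).
have := q_coc (e i1) (e i2).
rewrite !e_vec3 !AI_vec3 !heis_bracket_vec3 !on_basis_vec3 !vec3E.
rewrite -!vec3B !(mul0r, mul1r, add0r, addr0, subr0, sub0r, oppr0).
move=> /vec3_inj[eq12_1 eq12_2 eq12_3] /vec3_inj[eq13_1 eq13_2 eq13_3].
move=> /vec3_inj[eq23_1 eq23_2 eq23_3].
split; split=> //.
- by rewrite eq12_2; ring.
- by apply/eqP; rewrite -subr_eq0 -eq13_1.
- by apply/eqP; rewrite -subr_eq0 -eq23_1.
Qed.

(** The hypothesis on the characteristic is needed: for a = a' = 0 in
    characteristic 2 there are bijective cocycles. *)
Lemma bijective_AI_cocycle_neq0 a a' (q : 'Hom(heis, V3)) :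
  2%:R != 0 :> K -> bijective_cocycle (AI a a') q -> a != 0.
Proof.
move=> nz2 [q_coc q_bij]; apply/eqP => a0; subst a.
have [[[p1 p2] p3] [[[r1 r2] r3] [[[s1 s2] s3] qE]]] := hom_vec3 q.
rewrite /= in qE.
have [[_ eq12_2 _] [eq13_1 _ _] [eq23_1 eq23_2 eq23_3]] :=
  AI_cocycle_eqs qE q_coc.
have q_inj x : q x = 0 -> x = 0.
  by move=> qx0; apply: (bij_inj q_bij); rewrite qx0 linear0.
rewrite mul0r add0r in eq13_1; rewrite mul0r sub0r in eq12_2.
have [a'0|nza'] := eqVneq a' 0.
  (* The third coordinates of q(e1), q(e2), q(e3) all vanish, so v3 is not in
     the image of q. *)
  subst a'; rewrite mul0r in eq23_1; rewrite !mul0r add0r in eq23_2.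
  have p3_0 : p3 = 0.
    apply/eqP; rewrite mul0r oppr0 sub0r eq13_1 in eq12_2.
    have : 2%:R * p3 == 0 by rewrite mulr_natl mulr2n {1}eq12_2 addNr.
    by rewrite mulf_eq0 (negPf nz2).
  have [h _ hK] := q_bij; have := hK (vec3 0 0 1).
  rewrite qE on_basis_vec3 => /vec3_inj[_ _ /eqP].
  by rewrite p3_0 -eq23_1 eq23_2 !mulr0 !addr0 eq_sym oner_eq0.
have s3_0 : s3 = 0.
  by apply/eqP; move/eqP: eq23_3; rewrite mulf_eq0 (negPf nza').
have s2_0 : s2 = 0.
  by apply/eqP; move/eqP: eq23_2; rewrite s3_0 addr0 mulf_eq0 (negPf nza').
have p3_0 : p3 = 0 by rewrite -eq13_1.
have p2_0 : p2 = 0.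
  apply/eqP; move/esym/eqP: eq12_2; rewrite s2_0 p3_0 subr0 oppr_eq0.
  by rewrite mulf_eq0 (negPf nza').
(* Now q(e1) = p1 v1 and q(e3) = s1 v1 are proportional. *)
have /q_inj : q (vec3 s1 0 (- p1)) = 0.
  rewrite qE on_basis_vec3 !vec3E p2_0 p3_0 s2_0 s3_0.
  by apply: row3P; rewrite vec3E mxE; ring.
rewrite -vec3_0 => /vec3_inj[_ _ /eqP]; rewrite oppr_eq0 => /eqP p1_0.
have /q_inj : q (e i1) = 0.
  rewrite qE e_vec3 on_basis_vec3 !vec3E p1_0 p2_0 p3_0.
  by rewrite !mulr0 !mul0r !addr0 vec3_0.
by rewrite e_vec3 -vec3_0 => /vec3_inj[/eqP]; rewrite oner_eq0.
Qed.

(** The general cocycle of the representation (AI) with a = 1, a' = b: the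
    parameters are the coordinates (p1, p2, s) of q(e1), and they determine
    q(e2) and q(e3). *)
Definition AI_cocycle (b p1 p2 s : K) : 'Hom(heis, V3) :=
  on_basis (vec3 p1 p2 s : V3) (vec3 (b * (p1 - p2)) (b * p2 + s) (b * s))
    (vec3 s 0 0).

Lemma AI1_cocycle_form b (q : 'Hom(heis, V3)) :
  cocycle (AI 1 b) q -> exists p1 p2 s, q = AI_cocycle b p1 p2 s.
Proof.
move=> q_coc.
have [[[p1 p2] p3] [[[r1 r2] r3] [[[s1 s2] s3] qE]]] := hom_vec3 q.
rewrite /= in qE.
have [[eq12_1 eq12_2 _] [eq13_1 eq13_2 eq13_3] [eq23_1 _ _]] :=
  AI_cocycle_eqs qE q_coc.
rewrite !mul1r in eq12_1 eq12_2 eq13_1 eq13_2 eq13_3.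
rewrite eq13_2 in eq12_2 eq13_1; rewrite eq13_2 eq13_3 in qE.
rewrite addr0 in eq13_1; rewrite eq13_1 in eq12_1 eq23_1 qE.
have r2E : r2 = b * p2 + p3.
  by apply/eqP; rewrite -subr_eq0 opprD addrA -eq12_2.
have r1E : r1 = b * (p1 - p2).
  by rewrite -[r1](addrK (r2 - b * p1)) addrA -eq12_1 r2E; ring.
by exists p1, p2, p3; rewrite qE /AI_cocycle r1E r2E eq23_1.
Qed.

Lemma AI_cocycle_bijective b p1 p2 s :
  s != 0 -> bijective_cocycle (AI 1 b) (AI_cocycle b p1 p2 s).
Proof.
move=> nzs; split=> [x y|].
  rewrite !AI_vec3 heis_bracket_vec3 /AI_cocycle !on_basis_vec3 !vec3E.
  by rewrite -vec3B; congr vec3; ring.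
apply: bij_lfun_ker0 => // x; rewrite /AI_cocycle on_basis_vec3 -vec3_0.
move=> /vec3_inj[qx1 qx2 qx3].
have x1E : x 0 i1 = - (b * x 0 i2).
  apply/eqP; rewrite -addr_eq0 -(mulIr_eq0 _ (mulIf nzs)) -[X in _ == X]qx3.
  by apply/eqP; ring.
have x2_0 : x 0 i2 = 0.
  apply/eqP; rewrite -(mulIr_eq0 _ (mulIf nzs)) -[X in _ == X]qx2 x1E.
  by apply/eqP; ring.
rewrite x2_0 mulr0 oppr0 in x1E.
have x3_0 : x 0 i3 = 0.
  apply/eqP; rewrite -(mulIr_eq0 _ (mulIf nzs)) -[X in _ == X]qx1 x1E x2_0.
  by apply/eqP; ring.
by rewrite [x]vec3_eta x1E x2_0 x3_0.
Qed.

Lemma bijective_AI_cocycle_lead b p1 p2 s :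
  bijective (AI_cocycle b p1 p2 s) -> s != 0.
Proof.
move=> /bij_inj q_inj; apply/eqP => s0.
have : AI_cocycle b p1 p2 s (e i3) = AI_cocycle b p1 p2 s 0.
  rewrite linear0 e_vec3 /AI_cocycle on_basis_vec3 !vec3E s0.
  by rewrite !mul0r !mulr0 !addr0 vec3_0.
move=> /q_inj; rewrite e_vec3 -vec3_0 => /vec3_inj[_ _ /eqP].
by rewrite oner_eq0.
Qed.

(** The automorphism is diag(al, de, al de), and the change of basis of V is
    diag(1, al, al de), which multiplies E_21, E_32, E_31 by al^-1, de^-1,
    (al de)^-1. *)
Lemma AI_rescale (a a' al de : K) :
  al != 0 -> de != 0 -> rep_equiv (AI a a') (AI (al * a) (de * a')).
Proof.
move=> nz_al nz_de; have nz_alde : al * de != 0 by rewrite mulf_neq0.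
have diag_bij (c1 c2 c3 : K) : c1 != 0 -> c2 != 0 -> c3 != 0 ->
    bijective (on_basis (vec3 c1 0 0 : V3) (vec3 0 c2 0) (vec3 0 0 c3)).
  move=> nz1 nz2 nz3; apply: bij_lfun_ker0 => // x.
  rewrite on_basis_vec3 !mulr0 !addr0 !add0r -vec3_0.
  move=> /vec3_inj[/eqP x1 /eqP x2 /eqP x3].
  rewrite mulf_eq0 (negPf nz1) orbF in x1.
  rewrite mulf_eq0 (negPf nz2) orbF in x2.
  rewrite mulf_eq0 (negPf nz3) orbF in x3.
  by rewrite [x]vec3_eta (eqP x1) (eqP x2) (eqP x3).
exists (on_basis (vec3 al 0 0 : V3) (vec3 0 de 0) (vec3 0 0 (al * de))).
exists (on_basis (vec3 1 0 0 : V3) (vec3 0 al 0) (vec3 0 0 (al * de))).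
have g_bij := diag_bij _ _ _ (oner_neq0 K) nz_al nz_alde.
split=> //; first split; first exact: diag_bij.
- move=> x y; rewrite !heis_bracket_vec3 !on_basis_vec3 !vec3E.
  by congr vec3; ring.
- apply: intertwiner_conj => // x u.
  by rewrite !AI_vec3 !on_basis_vec3 !vec3E; congr vec3; ring.
Qed.

(** * Uniqueness up to equivalence *)

Lemma AI_cocycle_normalize (b p1 p2 s : K) :
  s != 0 ->
  cocycle_equiv (AI 1 b) (AI_cocycle b p1 p2 s) (AI 1 b) (AI_cocycle b 0 0 1).
Proof.
move=> nzs.
(* With g = s^-1 (id + m E_32 + n E_31), the coefficient m of e3 in T e1 is
   the same as that of E_32 because g must intertwine f(T x) and f(x); m and n
   are then chosen to cancel the v2- and v1-coordinates of g q(T e1). *)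
pose m := - (p2 / s); pose n := (p2 - p1) / s.
pose T : 'End(heis) := on_basis (vec3 1 0 m : V3) (vec3 0 1 0) (vec3 0 0 1).
pose g : 'End(V3) := on_basis (vec3 s^-1 0 0 : V3) (vec3 0 s^-1 0)
                       (vec3 (s^-1 * n) (s^-1 * m) s^-1).
have nzsV : s^-1 != 0 by rewrite invr_eq0.
have g_bij : bijective g.
  apply: bij_lfun_ker0 => // x; rewrite /g on_basis_vec3 -vec3_0.
  move=> /vec3_inj[gx1 gx2 gx3].
  rewrite !mulr0 !add0r in gx3 gx2 gx1; rewrite ?addr0 in gx1.
  move/eqP: gx3; rewrite mulf_eq0 (negPf nzsV) orbF => /eqP x3_0.
  rewrite x3_0 !mul0r !addr0 in gx1 gx2.
  move/eqP: gx2; rewrite mulf_eq0 (negPf nzsV) orbF => /eqP x2_0.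
  move/eqP: gx1; rewrite mulf_eq0 (negPf nzsV) orbF => /eqP x1_0.
  by rewrite [x]vec3_eta x1_0 x2_0 x3_0.
exists T, g; split=> //.
- split=> [|x y]; last first.
    rewrite !heis_bracket_vec3 !on_basis_vec3 !vec3E.
    by congr vec3; ring.
  apply: bij_lfun_ker0 => // x; rewrite /T on_basis_vec3 -vec3_0.
  rewrite !(mulr0, mulr1, addr0, add0r) => /vec3_inj[x1_0 x2_0].
  rewrite x1_0 mul0r add0r => x3_0.
  by rewrite [x]vec3_eta x1_0 x2_0 x3_0.
- apply: intertwiner_conj => // x u.
  by rewrite !AI_vec3 !on_basis_vec3 !vec3E; congr vec3; ring.
- apply/lfunP => x; rewrite !comp_lfunE /AI_cocycle !on_basis_vec3 !vec3E.
  by congr vec3; rewrite /m /n; field.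
Qed.

Lemma bijective_cocycle_AI1_unique b (q : 'Hom(heis, V3)) :
  bijective_cocycle (AI 1 b) q ->
  cocycle_equiv (AI 1 b) q (AI 1 b) (AI_cocycle b 0 0 1).
Proof.
move=> [/AI1_cocycle_form[p1 [p2 [s ->]]] /bijective_AI_cocycle_lead nzs].
exact: AI_cocycle_normalize.
Qed.

(** * The left-symmetric products *)

Lemma table_mulE (t : seq (seq 'rV[K]_3)) (x y : 'rV[K]_3) :
  table_mul t x y =
  let c i j := (nth [::] t i)`_j in
  x 0 i1 *: (y 0 i1 *: c 0 0 + y 0 i2 *: c 0 1 + y 0 i3 *: c 0 2) +
  x 0 i2 *: (y 0 i1 *: c 1 0 + y 0 i2 *: c 1 1 + y 0 i3 *: c 1 2) +
  x 0 i3 *: (y 0 i1 *: c 2 0 + y 0 i2 *: c 2 1 + y 0 i3 *: c 2 2).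
Proof.
rewrite /table_mul !big_ord_recl !big_ord0 !addr0 /= !scalerDr !scalerA.
rewrite (_ : lift ord0 ord0 = i2); last exact: val_inj.
rewrite (_ : lift ord0 (lift ord0 ord0) = i3); last exact: val_inj.
by rewrite !addrA.
Qed.

Lemma H1_vec3 (x y : heis) :
  H1_mul x y = vec3 (x 0 i1 * y 0 i1) (x 0 i1 * y 0 i2 + x 0 i2 * y 0 i1)
    (x 0 i1 * y 0 i2 + x 0 i1 * y 0 i3 + x 0 i3 * y 0 i1).
Proof.
by rewrite /H1_mul table_mulE; apply: row3P; rewrite vec3E !mxE /=; ring.
Qed.

Lemma H2'_vec3 (x y : heis) :
  H2'_mul x y =
  vec3 (x 0 i1 * y 0 i1 - x 0 i2 * y 0 i2)
    (x 0 i1 * y 0 i2 + x 0 i2 * y 0 i1 + 2%:R * (x 0 i2 * y 0 i2))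
    (x 0 i1 * y 0 i2 + x 0 i1 * y 0 i3 + x 0 i2 * y 0 i3
      + x 0 i3 * y 0 i1 + x 0 i3 * y 0 i2).
Proof.
by rewrite /H2'_mul table_mulE; apply: row3P; rewrite vec3E !mxE /=; ring.
Qed.

Lemma H2_vec3 (x y : heis) :
  H2_mul x y =
  vec3 (x 0 i1 * y 0 i1) (x 0 i1 * y 0 i2 + x 0 i2 * y 0 i1)
    (x 0 i1 * y 0 i2 + x 0 i1 * y 0 i3 + x 0 i2 * y 0 i2 + x 0 i3 * y 0 i1).
Proof.
by rewrite /H2_mul table_mulE; apply: row3P; rewrite vec3E !mxE /=; ring.
Qed.

(** The identity x * y = m(x, y) is checked in the form
    f(x) q(y) = q(m(x, y)). *)
Lemma cocycle_mul_AI_1_0 (x y : heis) :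
  cocycle_mul (AI 1 0) (AI_cocycle 0 0 0 1) x y = H1_mul x y.
Proof.
have [_ q_bij] := AI_cocycle_bijective 0 0 0 (oner_neq0 K).
apply: (bij_inj q_bij); rewrite /cocycle_mul bij_lfunVK // H1_vec3 AI_vec3.
by rewrite /AI_cocycle !on_basis_vec3 !vec3E; congr vec3; ring.
Qed.

Lemma cocycle_mul_AI_1_1 (x y : heis) :
  cocycle_mul (AI 1 1) (AI_cocycle 1 0 0 1) x y = H2'_mul x y.
Proof.
have [_ q_bij] := AI_cocycle_bijective 1 0 0 (oner_neq0 K).
apply: (bij_inj q_bij); rewrite /cocycle_mul bij_lfunVK // H2'_vec3 AI_vec3.
by rewrite /AI_cocycle !on_basis_vec3 !vec3E; congr vec3; ring.
Qed.

Lemma AI_cocycle_0 : AI_cocycle 0 0 0 1 = on_basis (v i3 : V3) (v i2) (v i1).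
Proof.
rewrite /AI_cocycle; congr on_basis; apply: row3P;
  by rewrite vec3E mxE /=; ring.
Qed.

Lemma AI_cocycle_1 :
  AI_cocycle 1 0 0 1 = on_basis (v i3 : V3) (v i2 + v i3) (v i1).
Proof.
rewrite /AI_cocycle; congr on_basis; apply: row3P;
  by rewrite vec3E !mxE /=; ring.
Qed.

(** * Isomorphism of (H-2)' and (H-2), and the classification *)

Lemma H2'_isomorphic_H2 : lsa_isomorphic (@H2'_mul K) (@H2_mul K).
Proof.
exists (on_basis (vec3 1 0 0 : heis) (vec3 1 (- 1) 0) (vec3 0 0 (- 1))).
split=> [|x y]; last first.
  by rewrite H2'_vec3 H2_vec3 !on_basis_vec3 !vec3E; congr vec3; ring.
apply: bij_lfun_ker0 => // x; rewrite on_basis_vec3 -vec3_0.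
rewrite !(mulr0, mulr1, addr0, add0r, mulrN1).
move=> /vec3_inj[x12_0 /eqP x2_0 /eqP x3_0].
rewrite oppr_eq0 in x2_0; rewrite oppr_eq0 in x3_0.
rewrite (eqP x2_0) addr0 in x12_0.
by rewrite [x]vec3_eta x12_0 (eqP x2_0) (eqP x3_0).
Qed.

Lemma AI_bijective_cocycleP a a' :
  2%:R != 0 :> K ->
  (exists q : 'Hom(heis, V3), bijective_cocycle (AI a a') q) <->
  (rep_equiv (AI a a') (AI (1 : K) 0) \/ rep_equiv (AI a a') (AI (1 : K) 1)).
Proof.
move=> nz2; split=> [[q /(bijective_AI_cocycle_neq0 nz2) nza]|].
  have nzaV : a^-1 != 0 by rewrite invr_eq0.
  have [->|nza'] := eqVneq a' 0.
    left; rewrite -(mulVf nza) -{2}(mulr0 1).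
    exact: AI_rescale nzaV (oner_neq0 K).
  right; rewrite -{1}(mulVf nza) -(mulVf nza').
  by apply: AI_rescale nzaV _; rewrite invr_eq0.
by case=> /rep_equiv_bijective_cocycle; apply;
  eexists; apply: (@AI_cocycle_bijective _ 0 0 1); apply: oner_neq0.
Qed.

End Heisenberg.

Local Open Scope complex_scope.

Theorem proposition3p2 (R : realType) :
  [/\ forall a a' : R[i],
        (exists q : 'Hom(heis R[i], V3 R[i]),
           bijective_cocycle (AI a a') q)
        <-> (rep_equiv (AI a a') (AI (1 : R[i]) 0)
             \/ rep_equiv (AI a a') (AI (1 : R[i]) 1)),
      let f := AI (1 : R[i]) 0 in
      let q := on_basis (v i3) (v i2) (v i1) in
      [/\ bijective_cocycle f q,
          forall q' : 'Hom(heis R[i], V3 R[i]),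
            bijective_cocycle f q' -> cocycle_equiv f q' f q,
          left_symmetric_algebra (cocycle_mul f q)
        & forall x y : heis R[i], cocycle_mul f q x y = H1_mul x y],
      let f := AI (1 : R[i]) 1 in
      let q := on_basis (v i3) (v i2 + v i3) (v i1) in
      [/\ bijective_cocycle f q,
          forall q' : 'Hom(heis R[i], V3 R[i]),
            bijective_cocycle f q' -> cocycle_equiv f q' f q,
          left_symmetric_algebra (cocycle_mul f q)
        & forall x y : heis R[i], cocycle_mul f q x y = H2'_mul x y]
    & lsa_isomorphic (@H2'_mul R[i]) (@H2_mul R[i])].
Proof.
have nz2 : 2%:R != 0 :> R[i] by rewrite Num.Theory.pnatr_eq0.
split.
- by move=> a a'; apply: AI_bijective_cocycleP.
- rewrite /= -AI_cocycle_0.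
  have q_bij := @AI_cocycle_bijective R[i] 0 0 0 1 (oner_neq0 _).
  split=> //.
  + by move=> q'; apply: bijective_cocycle_AI1_unique.
  + exact: (cocycle_mul_lsa q_bij).
  + exact: cocycle_mul_AI_1_0.
- rewrite /= -AI_cocycle_1.
  have q_bij := @AI_cocycle_bijective R[i] 1 0 0 1 (oner_neq0 _).
  split=> //.
  + by move=> q'; apply: bijective_cocycle_AI1_unique.
  + exact: (cocycle_mul_lsa q_bij).
  + exact: cocycle_mul_AI_1_1.
- exact: H2'_isomorphic_H2.
Qed.
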